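(* Let $R=R(S,\kappa)$ be a near-integral fusion ring. Any $\varphi\in\mathrm{Irr}(S)$ with $\varphi\neq\mathrm{FPdim}$ extends uniquely to $\tilde{\varphi}\in\mathrm{Irr}(R)$ such that $\tilde{\varphi}(\rho)=0$.
   Context: A fusion ring $(R,B)$ is a unital associative ring $R$, free as a $\mathbb{Z}$-module with finite basis $B=\{1_R=b_1,\ldots,b_n\}$, such that $b_ib_j=\sum_k c_{ij}^kb_k$ with $c_{ij}^k\in\mathbb{Z}_{\geq0}$, together with an involution $\ast$ of $\{1,\ldots,n\}$ such that $\sum_ja_jb_j\mapsto\sum_ja_jb_{j^\ast}$ is an antiautomorphism of $R$ and $c_{ij}^1=1$ if $i=j^\ast$ and $0$ otherwise. $\mathrm{FPdim}:R\to\mathbb{C}$ is the ring homomorphism sending each $b_i\in B$ to the maximal real eigenvalue of $[c_{ij}^k]_{j,k}$. A fusion subring is a fusion ring $(S,C)$ with $C\subseteq B$ and $S\subseteq R$ the $\mathbb{Z}$-span of $C$. $(R,B)$ is near-integral if it has a fusion subring $(S,C)$ with $|C|+1=|B|$. Then $\rho$ denotes the unique element of $B\setminus C$, $\kappa:=c_{\rho,\rho}^\rho\in\mathbb{Z}_{\geq0}$, and $R$ is denoted $R(S,\kappa)$; its fusion rules are those of $S$ together with $x\rho=\rho x=\mathrm{FPdim}(x)\rho$ for $x\in C$ and $\rho^2=\kappa\rho+\sum_{x\in C}\mathrm{FPdim}(x)x$. $\mathrm{Irr}(R)$ denotes the set of (isomorphism classes of) finite-dimensional complex irreducible representations $R\to\mathrm{End}(V)$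 of the fusion ring $R$ (equivalently of the semisimple algebra $R\otimes_{\mathbb{Z}}\mathbb{C}$). *)

(* Defs.v *)
From HB Require Import structures.
From mathcomp Require Import all_boot all_order all_algebra.
From mathcomp Require Import complex.
From mathcomp Require Import boolp classical_sets reals.

Set Implicit Arguments.
Unset Strict Implicit.
Unset Printing Implicit Defensive.

Import Order.TTheory GRing.Theory Num.Theory.
Local Open Scope ring_scope.
Local Open Scope complex_scope.

Definition zcomb (R : nzRingType) (I : finType) (b : I -> R)
    (a : {ffun I -> int}) : R :=
  \sum_i b i *~ a i.

(* The value is meaningful only when [b] is a Z-basis of [R], in which case
   exactly one [a] satisfies the condition; the default 0 is then not used. *)
Definition zcoord (R : nzRingType) (I : finType) (b : I -> R) (x : R) :
    {ffun I -> int} :=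
  xget 0 [set a | zcomb b a = x]%classic.

Definition antiautomorphism (R : nzRingType) (s : R -> R) : Prop :=
  [/\ bijective s, s 1 = 1, {morph s : x y / x + y}
    & forall x y, s (x * y) = s y * s x].

(* The basis is indexed from 0, so [fbasis ord0] is the element b_1 = 1_R of the
   usual numbering, and [fcst i j k] is the coefficient of b_k in b_i b_j. *)
Record fusionRing : Type := FusionRing {
  fcarrier :> nzRingType;
  frank_pred : nat;
  fbasis : 'I_frank_pred.+1 -> fcarrier;
  fcst : 'I_frank_pred.+1 -> 'I_frank_pred.+1 -> 'I_frank_pred.+1 -> nat;
  fdual : 'I_frank_pred.+1 -> 'I_frank_pred.+1;
  fbasis_free : bijective (zcomb fbasis);
  fbasis1 : fbasis ord0 = 1;
  fbasisM : forall i j, fbasis i * fbasis j = \sum_k fbasis k *+ fcst i j k;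
  fdualK : involutive fdual;
  fdual_antiaut :
    antiautomorphism (fun x => zcomb (fbasis \o fdual) (zcoord fbasis x));
  fcst_dual : forall i j, fcst i j ord0 = (i == fdual j)
}.

Definition frank (A : fusionRing) : nat := (frank_pred A).+1.

Definition fusion_mx (K : realType) (A : fusionRing)
    (i : 'I_(frank_pred A).+1) : 'M[K]_((frank_pred A).+1) :=
  \matrix_(j, k) (fcst i j k)%:R.

(* The default 0 is never used for fusion matrices: a nonnegative matrix has a
   real eigenvalue, and only finitely many, so a maximal one exists. *)
Definition max_real_eigenvalue (K : realType) (n : nat) (M : 'M[K]_n) : K :=
  xget 0 [set a | eigenvalue M a /\ forall b, eigenvalue M b -> b <= a]%classic.

(* The additive extension to [A] of b_i |-> maximal real eigenvalue; that it is
   multiplicative is a theorem (Perron-Frobenius), not part of the definition. *)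
Definition FPdim (K : realType) (A : fusionRing) (x : A) : K[i] :=
  \sum_i (max_real_eigenvalue (fusion_mx K i))%:C *~ zcoord (@fbasis A) x i.

(* The inclusion of a fusion subring (S, C) in (R, B): [S] is identified with
   its image, which is the Z-span of the image C of its basis. *)
Record fusionSubring (S R : fusionRing) : Type := FusionSubring {
  fincl :> {rmorphism S -> R};
  fincl_inj : injective fincl;
  fincl_basis : forall i, exists j, fincl (fbasis i) = fbasis j
}.

(* R = R(S, kappa), with [fbasis rho] the element of B \ C, which is unique by
   the condition on cardinalities. *)
Record near_integral (S R : fusionRing) (iota : fusionSubring S R)
    (rho : 'I_(frank_pred R).+1) (kappa : nat) : Prop := NearIntegral {
  near_integral_rank : (frank S + 1 = frank R)%N;
  near_integral_rho : forall i, iota (fbasis i) <> fbasis rho;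
  near_integral_kappa : kappa = fcst rho rho rho
}.

Definition is_rep (K : realType) (A : nzRingType) (V : vectType K[i])
    (f : A -> 'End(V)) : Prop :=
  [/\ f 1 = \1%VF, {morph f : x y / x + y}
    & forall x y, f (x * y) = (f x \o f y)%VF].

Definition is_irrep (K : realType) (A : nzRingType) (V : vectType K[i])
    (f : A -> 'End(V)) : Prop :=
  [/\ is_rep f, fullv != 0%VS :> {vspace V}
    & forall U : {vspace V},
        (forall x, (f x @: U <= U)%VS) -> U = 0%VS \/ U = fullv].

Definition rep_iso (K : realType) (A : nzRingType) (V W : vectType K[i])
    (f : A -> 'End(V)) (g : A -> 'End(W)) : Prop :=
  exists2 u : 'Hom(V, W), bijective u
    & forall x, (u \o f x)%VF = (g x \o u)%VF.

(* FPdim as an action of [A] on the one-dimensional space C. *)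
Definition FPdim_rep (K : realType) (A : fusionRing) (x : A) : 'End(K[i]^o) :=
  FPdim K x *: \1%VF.

(* Main.v *)
(** The coefficient of the unit is a symmetric trace on [R], and it kills
    [rho * s] for [s] in [S]; hence [S rho] and [rho S] lie in [Z rho], the
    projection of [R = S + Z rho] onto [S] is [S]-bilinear, and [s rho = d(s) rho]
    for a nonnegative character [d] of [S], which is FPdim by Perron-Frobenius.
    Let [N] be the [S]-part of [rho^2].  From [s rho^2 = d(s) rho^2] one gets
    [s N = d(s) N], so the image of [phi(N)] is a subrepresentation on which [S]
    acts through FPdim: by irreducibility it is all of [V], forcing [phi] to be
    FPdim, or it is zero.  As [phi(N) = 0], composing [phi] with the projection
    is multiplicative. *)

Require Import Defs.
From HB Require Import structures.
From mathcomp Require Import all_boot all_order all_algebra.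
From mathcomp Require Import complex.
From mathcomp Require Import boolp classical_sets reals.

Set Implicit Arguments.
Unset Strict Implicit.
Unset Printing Implicit Defensive.

Import Order.TTheory GRing.Theory Num.Theory.
Local Open Scope ring_scope.
Local Open Scope complex_scope.

Section FusionCoordinates.
Variable A : fusionRing.
Local Notation I := 'I_(frank_pred A).+1.
Local Notation b := (@fbasis A).
Implicit Types (i j k : I) (x y : A).

Definition fcoord k x : int := zcoord b x k.

Lemma zcoordK x : zcomb b (zcoord b x) = x.
Proof.
case: (fbasis_free A) => g _ gK.
by rewrite /zcoord; case: xgetP => [a _ //|/(_ (g x))]; rewrite /= gK.
Qed.

Lemma zcombK a : zcoord b (zcomb b a) = a.
Proof. exact: (bij_inj (fbasis_free A) (zcoordK _)). Qed.

Lemma fcoord_is_zmod_morphism k : zmod_morphism (fcoord k).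
Proof.
move=> x y; rewrite /fcoord.
suff -> : zcoord b (x - y) = zcoord b x - zcoord b y by rewrite !ffunE.
apply: (bij_inj (fbasis_free A)); rewrite zcoordK /zcomb.
rewrite -{1}(zcoordK x) -{1}(zcoordK y) /zcomb -sumrB.
by apply: eq_bigr => i _; rewrite !ffunE mulrzBr.
Qed.

HB.instance Definition _ k :=
  GRing.isZmodMorphism.Build _ _ (fcoord k) (fcoord_is_zmod_morphism k).

Lemma fcoord_sum x : x = \sum_k b k *~ fcoord k x.
Proof. by rewrite -{1}(zcoordK x). Qed.

Lemma fcoord_basis k i : fcoord k (b i) = (i == k)%:R.
Proof.
rewrite /fcoord (_ : b i = zcomb b [ffun j => (i == j)%:R]) ?zcombK ?ffunE //.
rewrite /zcomb (bigD1 i) //= ffunE eqxx big1 ?addr0 ?mulr1z // => j.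
by rewrite eq_sym ffunE => /negbTE ->; rewrite mulr0z.
Qed.

Lemma fbasis_inj : injective b.
Proof.
move=> i j eij; have := fcoord_basis j i.
by rewrite eij fcoord_basis eqxx; case: eqP.
Qed.

Lemma fusion_ind (P : A -> Prop) :
  (forall x y, P x -> P y -> P (x - y)) -> (forall i, P (b i)) ->
  forall x, P x.
Proof.
move=> PB Pb x; rewrite (fcoord_sum x).
have P0 : P 0 by rewrite -(subrr (b ord0)); apply: PB.
have PN y : P y -> P (- y) by rewrite -sub0r; apply: PB.
have PD y z : P y -> P z -> P (y + z).
  by move=> Py Pz; rewrite -[z]opprK; apply/PB/PN.
have Pn y n : P y -> P (y *+ n).
  by move=> Py; elim: n => [|n IHn]; rewrite ?mulr0n // mulrS; apply: PD.
apply: big_ind => // i _; case: (fcoord i x) => n; first exact: Pn.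
exact/PN/Pn.
Qed.

Lemma fcoordM k i j : fcoord k (b i * b j) = (fcst i j k)%:R.
Proof.
rewrite fbasisM raddf_sum (bigD1 k) //= raddfMn /= fcoord_basis eqxx.
rewrite big1 ?addr0 // => l /negbTE lk.
by rewrite raddfMn /= fcoord_basis lk mul0rn.
Qed.

Lemma fcoord0M i j : fcoord ord0 (b i * b j) = (i == fdual j)%:R.
Proof. by rewrite fcoordM fcst_dual. Qed.

Lemma fcoord0C x y : fcoord ord0 (x * y) = fcoord ord0 (y * x).
Proof.
elim/fusion_ind: x => [x1 x2 IH1 IH2|i].
  by rewrite mulrBl mulrBr !raddfB /= IH1 IH2.
elim/fusion_ind: y => [y1 y2 IH1 IH2|j].
  by rewrite mulrBl mulrBr !raddfB /= IH1 IH2.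
by rewrite !fcoord0M eq_sym (can2_eq (@fdualK A) (@fdualK A)).
Qed.

Lemma fcoordE k x : fcoord k x = fcoord ord0 (x * b (fdual k)).
Proof.
elim/fusion_ind: x => [x y IHx IHy|i]; first by rewrite mulrBl !raddfB /= IHx IHy.
by rewrite fcoord0M fdualK fcoord_basis.
Qed.

End FusionCoordinates.

(* A nonnegative character is a common positive eigenvector of the fusion
   matrices, so it realises their Perron-Frobenius eigenvalues. *)
Section NonnegativeCharacter.
Variables (K : realType) (A : fusionRing) (d : A -> int).
Hypothesis dB : zmod_morphism d.
Hypothesis dM : {morph d : x y / x * y}.
Hypothesis d1 : d 1 = 1.
Hypothesis d_ge0 : forall i, 0 <= d (fbasis i).

HB.instance Definition _ := GRing.isZmodMorphism.Build _ _ d dB.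

Lemma character_fbasis_gt0 i : 0 < d (fbasis i).
Proof.
rewrite lt0r d_ge0 andbT; apply: contraTneq isT => di0.
have := dM (fbasis i) (fbasis (fdual i)); rewrite di0 mul0r fbasisM raddf_sum /=.
rewrite (bigD1 ord0) //= raddfMn /= fbasis1 d1 fcst_dual fdualK eqxx /=.
move=> e; suff : 1 <= 0 :> int by [].
rewrite -[leRHS]e lerDl sumr_ge0 // => k _.
by rewrite raddfMn /= mulrn_wge0.
Qed.

Lemma fusion_mx_character i j :
  \sum_k fusion_mx K i j k * (d (fbasis k))%:~R =
  (d (fbasis i))%:~R * (d (fbasis j))%:~R.
Proof.
rewrite -intrM -dM fbasisM !raddf_sum /=.
by apply: eq_bigr => k _; rewrite mxE !raddfMn /= mulr_natl.
Qed.

Lemma max_real_eigenvalue_character i :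
  max_real_eigenvalue (fusion_mx K i) = (d (fbasis i))%:~R.
Proof.
pose D k : K := (d (fbasis k))%:~R.
have D_gt0 k : 0 < D k by rewrite ltr0z character_fbasis_gt0.
have evD : eigenvalue (fusion_mx K i) (D i).
  have : eigenvalue (fusion_mx K i)^T (D i).
    apply/eigenvalueP; exists (\row_k D k).
      apply/rowP => j; rewrite !mxE -fusion_mx_character.
      by apply: eq_bigr => k _; rewrite !mxE mulrC.
    apply/eqP => /rowP/(_ ord0); rewrite !mxE => D0.
    by have := D_gt0 ord0; rewrite D0 ltxx.
  rewrite !eigenvalue_root_char (_ : char_poly _^T = char_poly (fusion_mx K i)) //.
  rewrite /char_poly -[RHS]det_tr; congr (\det _).
  by apply/matrixP => j k; rewrite !mxE eq_sym.
have le_D a : eigenvalue (fusion_mx K i) a -> a <= D i.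
  case/eigenvalueP => v va v0; apply: le_trans (ler_norm a) _.
  pose s := \sum_k `|v 0 k| * D k.
  have s_gt0 : 0 < s.
    have [k vk0] : exists k, v 0 k != 0.
      apply/existsP; apply: contraNT v0; rewrite negb_exists => /forallP v0.
      by apply/eqP/rowP => k; rewrite mxE; apply/eqP; have := v0 k; rewrite negbK.
    rewrite /s (bigD1 k) //= ltr_pwDl //; first by rewrite mulr_gt0 ?normr_gt0.
    by apply: sumr_ge0 => l _; rewrite mulr_ge0 // ltW.
  rewrite -(ler_pM2r s_gt0) /s !mulr_sumr.
  apply: (@le_trans _ _ (\sum_k \sum_j `|v 0 j| * fusion_mx K i j k * D k)).
    apply: ler_sum => k _; rewrite mulrA -mulr_suml ler_pM2r // -normrM.
    move/rowP/(_ k): va; rewrite !mxE => <-.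
    apply: le_trans (ler_norm_sum _ _ _) _; apply: ler_sum => j _.
    by rewrite normrM !mxE normr_nat.
  rewrite exchange_big /=; apply: ler_sum => j _.
  rewrite mulrCA -fusion_mx_character mulr_sumr.
  by under eq_bigr do rewrite -mulrA.
rewrite /max_real_eigenvalue; apply: xget_unique => // a [eva lea].
by apply/eqP; rewrite eq_le le_D //= lea.
Qed.

Lemma FPdim_character x : FPdim K x = (d x)%:~R.
Proof.
rewrite /FPdim [in RHS](fcoord_sum x) !raddf_sum /=; apply: eq_bigr => i _.
by rewrite max_real_eigenvalue_character !raddfMz .
Qed.

End NonnegativeCharacter.

Section NearIntegral.
Variables (S R : fusionRing) (iota : fusionSubring S R).
Variables (rho : 'I_(frank_pred R).+1) (kappa : nat).
Hypothesis hR : near_integral iota rho kappa.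
Local Notation J := 'I_(frank_pred S).+1.
Local Notation r := (fbasis rho).
Implicit Types (i k : J) (s t : S) (x y : R).

Definition incl_index i := sval (cid (fincl_basis iota i)).

Lemma fincl_fbasis i : iota (fbasis i) = fbasis (incl_index i).
Proof. by rewrite /incl_index; case: cid. Qed.

Lemma incl_index_inj : injective incl_index.
Proof.
move=> i k eik; apply/(@fbasis_inj S)/(fincl_inj (f := iota)).
by rewrite !fincl_fbasis eik.
Qed.

Lemma incl_index0 : incl_index ord0 = ord0.
Proof. by apply: (@fbasis_inj R); rewrite -fincl_fbasis !fbasis1 rmorph1. Qed.

Lemma incl_index_neq_rho i : incl_index i != rho.
Proof.
by apply/eqP => e; apply: (near_integral_rho hR (i := i)); rewrite fincl_fbasis e.
Qed.

Lemma incl_indexP j : j != rho -> exists i, j = incl_index i.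
Proof.
move=> jr; suff /imsetP[i _ ->] : j \in [set incl_index i | i in J] by exists i.
suff -> : [set incl_index i | i in J] = [set~ rho] by rewrite !inE.
apply/eqP; rewrite eqEcard cardsC1 card_imset; last exact: incl_index_inj.
apply/andP; split; last first.
  by rewrite !card_ord; have := near_integral_rank hR; rewrite /frank addn1 => -[<-].
by apply/fintype.subsetP => l /imsetP[i _ ->]; rewrite !inE incl_index_neq_rho.
Qed.

Lemma fcoord_incl k s : fcoord (incl_index k) (iota s) = fcoord k s.
Proof.
elim/fusion_ind: s => [s t IHs IHt|i]; first by rewrite !raddfB /= IHs IHt.
by rewrite fincl_fbasis !fcoord_basis (inj_eq incl_index_inj).
Qed.

Lemma incl_index_dual i : incl_index (fdual i) = fdual (incl_index i).
Proof.
apply: (inv_inj (@fdualK R)); rewrite fdualK; apply/eqP; rewrite eq_sym.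
have := fcoord_incl ord0 (fbasis i * fbasis (fdual i)).
rewrite rmorphM /= !fincl_fbasis incl_index0 !fcoord0M fdualK eqxx.
by case: eqP.
Qed.

Lemma fdual_rho : fdual rho = rho.
Proof.
apply: contraPP (@incl_index_neq_rho) => /eqP/incl_indexP[i ei].
by move/(_ (fdual i)); rewrite incl_index_dual -ei fdualK eqxx.
Qed.

Definition proj x : S := \sum_i fbasis i *~ fcoord (incl_index i) x.

Lemma proj_is_zmod_morphism : zmod_morphism proj.
Proof.
by move=> x y; rewrite /proj -sumrB; apply: eq_bigr => i _; rewrite raddfB mulrzBr.
Qed.

HB.instance Definition _ :=
  GRing.isZmodMorphism.Build _ _ proj proj_is_zmod_morphism.

Lemma proj_incl s : proj (iota s) = s.
Proof.
by rewrite [RHS]fcoord_sum; apply: eq_bigr => i _; rewrite fcoord_incl.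
Qed.

Lemma proj_rho : proj r = 0.
Proof.
by apply: big1 => i _; rewrite fcoord_basis eq_sym (negbTE (incl_index_neq_rho i)).
Qed.

Lemma fusion_decomp x : x = iota (proj x) + r *~ fcoord rho x.
Proof.
elim/fusion_ind: x => [x y IHx IHy|j].
  by rewrite {1}IHx {1}IHy !raddfB /= opprD addrACA.
have [->|/incl_indexP[i ->]] := eqVneq j rho.
  by rewrite proj_rho raddf0 add0r fcoord_basis eqxx.
rewrite -fincl_fbasis proj_incl fincl_fbasis fcoord_basis.
by rewrite (negbTE (incl_index_neq_rho i)) addr0.
Qed.

Lemma fcoord0_rho_incl s : fcoord ord0 (r * iota s) = 0.
Proof.
elim/fusion_ind: s => [s t IHs IHt|i].
  by rewrite raddfB /= mulrBr raddfB /= IHs IHt subrr.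
rewrite fincl_fbasis fcoord0M -incl_index_dual eq_sym.
by rewrite (negbTE (incl_index_neq_rho _)).
Qed.

Lemma proj_incl_rho s : proj (iota s * r) = 0.
Proof.
apply: big1 => i _; rewrite fcoordE -incl_index_dual -fincl_fbasis fcoord0C.
by rewrite mulrA -rmorphM fcoord0C fcoord0_rho_incl.
Qed.

Lemma proj_rho_incl s : proj (r * iota s) = 0.
Proof.
apply: big1 => i _; rewrite fcoordE -incl_index_dual -fincl_fbasis.
by rewrite -mulrA -rmorphM fcoord0_rho_incl.
Qed.

Definition rho_char s : int := fcoord rho (iota s * r).

Lemma incl_rho s : iota s * r = r *~ rho_char s.
Proof. by rewrite [LHS]fusion_decomp proj_incl_rho raddf0 add0r. Qed.

Lemma rho_char_is_zmod_morphism : zmod_morphism rho_char.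
Proof. by move=> s t; rewrite /rho_char raddfB /= mulrBl raddfB. Qed.

HB.instance Definition _ :=
  GRing.isZmodMorphism.Build _ _ rho_char rho_char_is_zmod_morphism.

Lemma rho_charM : {morph rho_char : s t / s * t}.
Proof.
move=> s t; rewrite {1}/rho_char rmorphM -mulrA incl_rho mulrzAr raddfMz /=.
by rewrite -/(rho_char s) -mulrzz.
Qed.

Lemma rho_char1 : rho_char 1 = 1.
Proof. by rewrite /rho_char rmorph1 mul1r fcoord_basis eqxx. Qed.

Lemma rho_char_ge0 i : 0 <= rho_char (fbasis i).
Proof. by rewrite /rho_char fincl_fbasis fcoordM ler0n. Qed.

Lemma FPdim_rho_char (K : realType) s : FPdim K s = (rho_char s)%:~R.
Proof.
exact: (FPdim_character K rho_char_is_zmod_morphism rho_charM rho_char1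
          rho_char_ge0).
Qed.

(* The element [\sum_(x in C) FPdim(x) x] of the usual fusion rules. *)
Definition rho2 : S := proj (r * r).

Lemma proj_inclM s x : proj (iota s * x) = s * proj x.
Proof.
rewrite [in LHS](fusion_decomp x) mulrDr raddfD /= -rmorphM proj_incl.
by rewrite mulrzAr raddfMz /= proj_incl_rho mul0rz addr0.
Qed.

Lemma proj_Mincl s x : proj (x * iota s) = proj x * s.
Proof.
rewrite [in LHS](fusion_decomp x) mulrDl raddfD /= -rmorphM proj_incl.
by rewrite mulrzAl raddfMz /= proj_rho_incl mul0rz addr0.
Qed.

Lemma mul_rho2 s : s * rho2 = rho2 *~ rho_char s.
Proof. by rewrite /rho2 -proj_inclM mulrA incl_rho mulrzAl raddfMz. Qed.

Lemma projM x y :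
  proj (x * y) = proj x * proj y + rho2 *~ (fcoord rho x * fcoord rho y).
Proof.
rewrite {1}(fusion_decomp y) mulrDr raddfD /= proj_Mincl; congr (_ + _).
rewrite mulrzAr raddfMz /= {1}(fusion_decomp x) mulrDl raddfD /= proj_incl_rho.
by rewrite add0r mulrzAl raddfMz mulrzA.
Qed.

End NearIntegral.

Section LineCoordinate.
Variables (F : fieldType) (V : vectType F) (v : V).

Definition line_coord (w : V) : F^o := coord [tuple v] ord0 w.

Lemma line_coord_is_linear : linear line_coord.
Proof. by move=> k w1 w2; rewrite /line_coord linearP. Qed.

HB.instance Definition _ :=
  GRing.isLinear.Build F V F^o _ line_coord line_coord_is_linear.

Lemma line_coord_bij : v != 0 -> <[v]>%VS = fullv -> bijective (linfun line_coord).
Proof.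
move=> v0 defV; exists (fun k : F^o => (k : F) *: v) => [w|k]; rewrite lfunE /=.
  have w_in : w \in <<[tuple v]>>%VS by rewrite span_seq1 defV memvf.
  by rewrite [RHS](coord_span w_in) big_ord1.
rewrite linearZ /= [line_coord v](@coord_free _ _ _ [tuple v] ord0 ord0).
  exact: mulr1.
by rewrite seq1_free.
Qed.

End LineCoordinate.

Lemma scalar_irrep_iso (K : realType) (A : nzRingType) (V : vectType K[i])
    (f : A -> 'End(V)) (c : A -> K[i]) :
  is_irrep f -> (forall a, f a = c a *: \1%VF) ->
  rep_iso f (fun a => c a *: \1%VF : 'End(K[i]^o)).
Proof.
move=> [_ V0 irr] f_scalar; have v0 : vpick (fullv : {vspace V}) != 0.
  by rewrite vpick0.
have [a||defV] := irr <[vpick fullv]>%VS.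
- rewrite limg_line -memvE f_scalar lfunE /= lfunE /=.
  by rewrite memvZ ?memv_line.
- by have := memv_line (vpick (fullv : {vspace V})) => /[swap] ->;
    rewrite memv0 (negbTE v0).
exists (linfun (line_coord (vpick fullv))); first exact: line_coord_bij.
move=> a; apply/lfunP => w; rewrite f_scalar !(lfunE, comp_lfunE) /=.
by rewrite linearZ !id_lfunE.
Qed.

Lemma repMz (K : realType) (A : nzRingType) (V : vectType K[i])
    (f : A -> 'End(V)) (n : int) :
  is_rep f -> {morph f : x / x *~ n}.
Proof.
move=> [_ fD _].
have fB : zmod_morphism f.
  by move=> x y; apply: (addIr (f y)); rewrite -fD !subrK.
pose fA : {additive A -> 'End(V)} :=
  HB.pack f (GRing.isZmodMorphism.Build _ _ f fB).
exact: (raddfMz fA).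
Qed.

Lemma irrep_rho2_eq0 (K : realType) (S R : fusionRing)
    (iota : fusionSubring S R) (rho : 'I_(frank_pred R).+1) (kappa : nat)
    (V : vectType K[i]) (phi : S -> 'End(V)) :
  near_integral iota rho kappa -> is_irrep phi ->
  ~ rep_iso phi (@FPdim_rep K S) -> phi (rho2 iota rho) = 0.
Proof.
move=> hR irr_phi; apply: contra_notP => /eqP N0.
case: (irr_phi) => rep_phi _ irr; case: (rep_phi) => _ _ phiM.
pose N := rho2 iota rho.
have phiN s : (phi s \o phi N)%VF = FPdim K s *: phi N.
  by rewrite -phiM (mul_rho2 hR) (FPdim_rho_char hR) (repMz _ rep_phi) scaler_int.
have [s||imN] := irr (limg (phi N)).
- apply/subvP => w /memv_imgP[w' /memv_imgP[w2 _ ->] ->].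
  by rewrite -comp_lfunE phiN lfunE /= memvZ // memv_img ?memvf.
- by move/eqP; rewrite -lkerE => /subvP k; case/eqP: N0; apply/lfunP => w;
    rewrite lfunE /=; apply/eqP; rewrite -memv_ker k ?memvf.
have phi_scalar s : phi s = FPdim K s *: \1%VF.
  apply/lfunP => w; have /memv_imgP[w' _ ->] : w \in limg (phi N).
    by rewrite imN memvf.
  by rewrite -comp_lfunE phiN !lfunE /= lfunE.
exact: scalar_irrep_iso irr_phi phi_scalar.
Qed.

Theorem proposition3p4 (K : realType) (S R : fusionRing)
    (iota : fusionSubring S R) (rho : 'I_(frank_pred R).+1) (kappa : nat)
    (hR : near_integral iota rho kappa)
    (V : vectType K[i]) (phi : S -> 'End(V))
    (hphi : is_irrep phi)
    (hne : ~ rep_iso phi (@FPdim_rep K S)) :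
  exists phit : R -> 'End(V),
    [/\ is_irrep phit,
        forall x : S, phit (iota x) = phi x,
        phit (fbasis rho) = 0,
        forall psi : R -> 'End(V), is_irrep psi ->
          (forall x : S, psi (iota x) = phi x) ->
          psi (fbasis rho) = 0 -> psi = phit
      & forall (W : vectType K[i]) (psi : R -> 'End(W)), is_irrep psi ->
          rep_iso (fun x : S => psi (iota x)) phi ->
          psi (fbasis rho) = 0 -> rep_iso psi phit].

Proof.
have phiN := irrep_rho2_eq0 hR hphi hne.
case: (hphi) => rep_phi V0 irr; case: (rep_phi) => phi1 phiD phiM.
have unique (W : vectType K[i]) (g : 'Hom(W, V)) (psi : R -> 'End(W)) :
    is_rep psi -> (forall s, (g \o psi (iota s))%VF = (phi s \o g)%VF) ->
    psi (fbasis rho) = 0 ->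
    forall x, (g \o psi x)%VF = (phi (proj iota x) \o g)%VF.
  move=> [_ psiD psiM] psi_iota psi_rho x.
  rewrite {1}(fusion_decomp hR x) psiD -mulrzr psiM psi_rho comp_lfun0l addr0.
  exact: psi_iota.
exists (phi \o proj iota); split.
- split=> //; last first.
    by move=> U U_stable; apply: irr => s; rewrite -(proj_incl iota s) U_stable.
  split=> [|x y|x y] /=; first by rewrite -(rmorph1 iota) proj_incl.
    by rewrite raddfD phiD.
  by rewrite (projM hR) phiD phiM (repMz _ rep_phi) phiN mul0rz addr0.
- by move=> s /=; rewrite proj_incl.
- by rewrite /= (proj_rho hR) -(mulr0z 0) (repMz _ rep_phi) mulr0z.
- move=> psi [rep_psi _ _] psi_iota psi_rho; apply: funext => x /=.
  rewrite -(comp_lfun1r (phi _)) -(unique V \1%VF psi) ?comp_lfun1l // => s.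
  by rewrite psi_iota comp_lfun1l comp_lfun1r.
- move=> W psi [rep_psi _ _] [u u_bij psi_iota] psi_rho.
  by exists u => //; apply: unique.
Qed.
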